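(* Suppose the linear complementarity (LC) model is well-posed, has the rank-one block structure, and has only nontrivial sub-problem solutions (the three properties defined in the context). Let $\mathbf{v}^* = (\mathbf{x}^*,\mathbf{u}^*,\mathbf{w}^* )$ be feasible for the optimal control problem (P) stated in the context. Then $\mathbf{v}^*$ is locally optimal for (P) if and only if the classical KKT conditions of (P) admit a primal-dual solution pair at $\mathbf{v}^*$, i.e. if and only if there exist KKT multipliers that together with $\mathbf{v}^*$ satisfy the classical KKT conditions of (P).
   Context: Notation: $\mathbb{N}_n=\{1,\dots,n\}$; superscripts in square brackets denote components of vectors or rows/entries of matrices ($f^{[j]}$, $M^{[j,:]}$); vector inequalities are componentwise; $a\perp b$ means $a^\top b=0$. LC model: state $x\in\mathbb{R}^{n_x}$, input $u\in\mathbb{R}^{n_u}$, complementarity variable $w\in\mathbb{R}^{n_w}$, $$x^+ = Ax+B_uu+B_ww+c,\qquad 0\le E_ww+E_xx+E_uu+e\ \perp\ w\ge 0,$$ with real matrices and vectors of compatible dimensions, $E_w\in\mathbb{R}^{n_w\times n_w}$. Well-posedness: for every fixed $(x,u)$, all $w$ solving the complementarity problem give the same successor state $x^+$. Rank-one block structure: there exist $n_b\in\mathbb{N}$ and a partition of the index set $\mathbb{N}_{n_w}$ into $n_b$ blocks of sizes $n_{w_1},\dots,n_{w_{n_b}}$ such that (after a corresponding simultaneous reordering of the components of $w$ and of the rows of the complementarity problem) the complementarity problem decomposes into independent sub-problems $$0\le M_iw_i+C_ix+D_iu+e_i\ \perp\ w_i\ge 0,\qquad i\in\mathbb{N}_{n_b},$$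 where $M_i=m_im_i^\top$ for some $m_i\in\mathbb{R}^{n_{w_i}}$ with $m_i^{[j]}\ne 0$ for all $j\in\mathbb{N}_{n_{w_i}}$. (So $E_w$ is block diagonal with blocks $M_i$, and $E_x,E_u,e$ are the vertical stackings of the $C_i,D_i,e_i$.) Nontrivial sub-problem solutions: for every $x\in\mathbb{R}^{n_x}$, $u\in\mathbb{R}^{n_u}$ and every $i\in\mathbb{N}_{n_b}$ there is $j\in\mathbb{N}_{n_{w_i}}$ with $C_i^{[j,:]}x+D_i^{[j,:]}u+e_i^{[j]}<0$. Optimal control problem (P): for a horizon $N\ge1$ and a given initial state $\bar x$, minimize over $\mathbf{u}=(u_0,\dots,u_{N-1})$, $\mathbf{x}=(x_0,\dots,x_N)$, $\mathbf{w}=(w_0,\dots,w_{N-1})$ $$J(\mathbf{v})=\ell_N(x_N)+\sum_{k=0}^{N-1}\ell_k(x_k,u_k)$$ subject to $x_0=\bar x$ and, for $k=0,\dots,N-1$, $$x_{k+1}=Ax_k+B_uu_k+B_ww_k+c,\qquad 0\le r_k(\mathbf{v})\ \perp\ w_k\ge0,\quad r_k(\mathbf{v}):=E_ww_k+E_xx_k+E_uu_k+e .$$ The costs $\ell_k:\mathbb{R}^{n_x}\times\mathbb{R}^{n_u}\to\mathbb{R}$ and $\ell_N:\mathbb{R}^{n_x}\to\mathbb{R}$ are convex and differentiable. Local optimality is with respect to all variables $(\mathbf{u},\mathbf{x},\mathbf{w})$ jointly. Classical KKT conditions of (P): here the orthogonality constraints are written as the single equality $\sum_k r_k(\mathbf{v})^\top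 w_k=0$. With multipliers $\hat\pi\in\mathbb{R}^{n_x}$, $\hat\mu_k\in\mathbb{R}^{n_x}$, $\hat\nu_{G,k},\hat\nu_{H,k}\in\mathbb{R}^{n_w}$ ($k=0,\dots,N-1$) and $\hat\xi\in\mathbb{R}$, the Lagrangian is $$\mathcal{L}=J(\mathbf{v})+\hat\pi^\top(x_0-\bar x)+\sum_k\hat\mu_k^\top(x_{k+1}-Ax_k-B_uu_k-B_ww_k-c)-\sum_k\hat\nu_{G,k}^\top r_k(\mathbf{v})-\sum_k\hat\nu_{H,k}^\top w_k+\hat\xi\sum_k r_k(\mathbf{v})^\top w_k .$$ The KKT conditions at a feasible $\mathbf{v}^*$ are: $\nabla_{\mathbf{v}}\mathcal{L}=0$ at $\mathbf{v}^*$; $\hat\nu_{G,k}\ge0$, $\hat\nu_{H,k}\ge0$; $\hat\nu_{G,k}^{[i]}=0$ whenever $r_k(\mathbf{v}^* )^{[i]}>0$; and $\hat\nu_{H,k}^{[i]}=0$ whenever $w_k^{*[i]}>0$. *)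

(* Defs.v *)
From HB Require Import structures.
From mathcomp Require Import all_boot all_order all_algebra.
From mathcomp Require Import all_classical all_reals all_analysis.

Set Implicit Arguments.
Unset Strict Implicit.
Unset Printing Implicit Defensive.

Import Order.TTheory GRing.Theory Num.Theory.
Import numFieldNormedType.Exports.

Local Open Scope classical_set_scope.
Local Open Scope ring_scope.

Definition dotv (R : realType) n (a b : 'cV[R]_n) : R := (a^T *m b) 0 0.

Definition vnonneg (R : realType) n (a : 'cV[R]_n) : Prop :=
  forall i, 0 <= a i 0.

(* 0 <= a _|_ b >= 0 *)
Definition complementary (R : realType) n (a b : 'cV[R]_n) : Prop :=
  [/\ vnonneg a, vnonneg b & dotv a b = 0].

Record lc_model (R : realType) (nx nu nw : nat) := LCModel {
  lcA : 'M[R]_nx;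
  lcBu : 'M[R]_(nx, nu);
  lcBw : 'M[R]_(nx, nw);
  lcc : 'cV[R]_nx;
  lcEw : 'M[R]_nw;
  lcEx : 'M[R]_(nw, nx);
  lcEu : 'M[R]_(nw, nu);
  lce : 'cV[R]_nw
}.

Section LCModelProperties.
Context (R : realType) (nx nu nw : nat) (sys : lc_model R nx nu nw).

Definition successor (x : 'cV[R]_nx) (u : 'cV[R]_nu) (w : 'cV[R]_nw) : 'cV[R]_nx :=
  lcA sys *m x + lcBu sys *m u + lcBw sys *m w + lcc sys.

Definition residual (x : 'cV[R]_nx) (u : 'cV[R]_nu) (w : 'cV[R]_nw) : 'cV[R]_nw :=
  lcEw sys *m w + lcEx sys *m x + lcEu sys *m u + lce sys.

(* Solvability of the complementarity problem is not required. *)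
Definition well_posed : Prop :=
  forall x u w1 w2,
    complementary (residual x u w1) w1 ->
    complementary (residual x u w2) w2 ->
    successor x u w1 = successor x u w2.

End LCModelProperties.

(* A partition of 'I_n into blocks together with a numbering of each block:   *)
(* the j-th element of block i is bindex i j. The bijection is the            *)
(* simultaneous reordering that turns the block structure into a contiguous   *)
(* one.                                                                       *)
Record block_partition (n : nat) := BlockPartition {
  nblocks : nat;
  bsize : 'I_nblocks -> nat;
  bindex : forall i : 'I_nblocks, 'I_(bsize i) -> 'I_n;
  bindexP : bijective (fun p : {i : 'I_nblocks & 'I_(bsize i)} =>
                         bindex (tagged p))
}.

Section BlockStructure.
Context (R : realType) (nx nu nw : nat) (sys : lc_model R nx nu nw).
Context (P : block_partition nw).

Definition blockM (i : 'I_(nblocks P)) : 'M[R]_(bsize i) :=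
  mxsub (@bindex _ P i) (@bindex _ P i) (lcEw sys).
Definition blockC (i : 'I_(nblocks P)) : 'M[R]_(bsize i, nx) :=
  rowsub (@bindex _ P i) (lcEx sys).
Definition blockD (i : 'I_(nblocks P)) : 'M[R]_(bsize i, nu) :=
  rowsub (@bindex _ P i) (lcEu sys).
Definition blocke (i : 'I_(nblocks P)) : 'cV[R]_(bsize i) :=
  rowsub (@bindex _ P i) (lce sys).

Definition rank_one_blocks : Prop :=
  (forall i i' : 'I_(nblocks P), i != i' ->
     mxsub (@bindex _ P i) (@bindex _ P i') (lcEw sys) = 0) /\
  (forall i : 'I_(nblocks P), exists2 m : 'cV[R]_(bsize i),
     forall j, m j 0 != 0 & blockM i = m *m m^T).

Definition nontrivial_subproblems : Prop :=
  forall (x : 'cV[R]_nx) (u : 'cV[R]_nu) (i : 'I_(nblocks P)),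
    exists j : 'I_(bsize i),
      (blockC i *m x + blockD i *m u + blocke i) j 0 < 0.

End BlockStructure.

(* v = (x, u, w), where column k of each matrix is the vector at stage k *)
Notation decision R nx nu nw N :=
  ('M[R]_(nx, N.+1) * 'M[R]_(nu, N) * 'M[R]_(nw, N))%type.

Section OptimalControl.
Context (R : realType) (nx nu nw N : nat).
Implicit Type v : decision R nx nu nw N.

Definition xk v (k : 'I_N.+1) : 'cV[R]_nx := col k v.1.1.
Definition uk v (k : 'I_N) : 'cV[R]_nu := col k v.1.2.
Definition wk v (k : 'I_N) : 'cV[R]_nw := col k v.2.

Definition stage (k : 'I_N) : 'I_N.+1 := widen_ord (leqnSn N) k.
Definition next_stage (k : 'I_N) : 'I_N.+1 := lift ord0 k.

Section Problem.
Context (sys : lc_model R nx nu nw) (xbar : 'cV[R]_nx).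
Context (ell : 'I_N -> 'cV[R]_nx * 'cV[R]_nu -> R) (ellN : 'cV[R]_nx -> R).

Definition rk v (k : 'I_N) : 'cV[R]_nw :=
  residual sys (xk v (stage k)) (uk v k) (wk v k).

Definition cost v : R :=
  ellN (xk v ord_max) + \sum_(k < N) ell k (xk v (stage k), uk v k).

Definition feasible v : Prop :=
  xk v ord0 = xbar /\
  forall k : 'I_N,
    xk v (next_stage k) = successor sys (xk v (stage k)) (uk v k) (wk v k) /\
    complementary (rk v k) (wk v k).

Definition locally_optimal v : Prop :=
  feasible v /\ \forall v' \near v, feasible v' -> cost v <= cost v'.

Record multipliers := Multipliers {
  mult_pi : 'cV[R]_nx;
  mult_mu : 'I_N -> 'cV[R]_nx;
  mult_nuG : 'I_N -> 'cV[R]_nw;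
  mult_nuH : 'I_N -> 'cV[R]_nw;
  mult_xi : R
}.

Definition lagrangian (l : multipliers) v : R :=
  cost v + dotv (mult_pi l) (xk v ord0 - xbar)
  + \sum_(k < N) dotv (mult_mu l k)
      (xk v (next_stage k) - successor sys (xk v (stage k)) (uk v k) (wk v k))
  - \sum_(k < N) dotv (mult_nuG l k) (rk v k)
  - \sum_(k < N) dotv (mult_nuH l k) (wk v k)
  + mult_xi l * \sum_(k < N) dotv (rk v k) (wk v k).

(* is_diff also asserts the differentiability of the Lagrangian: 'd alone is  *)
(* a default value at points where it does not exist.                         *)
Definition kkt v (l : multipliers) : Prop :=
  [/\ is_diff v (lagrangian l) (cst 0),
      forall k, vnonneg (mult_nuG l k),
      forall k, vnonneg (mult_nuH l k),
      forall k i, 0 < rk v k i 0 -> mult_nuG l k i 0 = 0 &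
      forall k i, 0 < wk v k i 0 -> mult_nuH l k i 0 = 0].

End Problem.

End OptimalControl.

(* Main.v *)
Require Import Defs.
From HB Require Import structures.
From mathcomp Require Import all_boot all_order all_algebra.
From mathcomp Require Import all_classical all_reals all_analysis.
From mathcomp Require Import ring lra.

Set Implicit Arguments.
Unset Strict Implicit.
Unset Printing Implicit Defensive.

Import Order.TTheory GRing.Theory Num.Theory.
Import numFieldNormedType.Exports.

Local Open Scope classical_set_scope.
Local Open Scope ring_scope.

(* Near a feasible point, the orthogonality constraints fix which of [w] and
   the residual [r] vanishes except at biactive indices, where both do. At a
   KKT point the resulting signs of the multipliers make the derivative of the
   cost nonnegative along every nearby feasible displacement, and convexity
   turns this into local optimality. Conversely, a local optimum minimizes the
   cost on the polyhedral branch where vanishing components of [w] stay zero,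
   so Farkas' lemma yields multipliers that are free where exactly one of
   [w], [r] vanishes; a large multiple of the orthogonality constraint makes
   these nonnegative. At a biactive index the multiplier of [w] is zero,
   because [w] can be shifted between indices of a rank-one block without
   changing [r] or, by well-posedness, the successor state. *)

(** * Farkas' lemma over an ordered field *)

(** Eliminating one constraint at a time makes the argument purely algebraic: no closedness of
    cones, no separation theorem, no bound on the dimension of [V]. *)
Lemma farkas_seq (R : realFieldType) (V : lmodType R) (I : eqType) (s : seq I)
    (a : I -> V -> R) (b : V -> R) :
  uniq s -> (forall i, scalar (a i)) -> scalar b ->
  (forall h, (forall i, i \in s -> 0 <= a i h) -> 0 <= b h) ->
  exists2 c : I -> R, forall i, 0 <= c i &
    forall h, b h = \sum_(i <- s) c i * a i h.
Proof.
elim: s a b => [|i0 s IHs] a b /=.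
  move=> _ _ lb b_ge0; exists (fun=> 0) => // h; rewrite big_nil.
  apply/le_anti; rewrite b_ge0// andbT -oppr_ge0.
  have b0 : b 0 = 0 by have := lb (-1) 0 0; rewrite scaler0 addr0; lra.
  have -> : - b h = b (- h) by rewrite -[- h]addr0 -scaleN1r lb b0; lra.
  exact: b_ge0.
move=> /andP[i0s us] la lb b_ge0.
(* Either [a i0] is redundant and gets weight zero, or some [h0] satisfies the remaining constraints
   with [b h0 < 0], which forces [a i0 h0 < 0]. *)
have [b_ge0'|] := pselect (forall h, (forall i, i \in s -> 0 <= a i h) -> 0 <= b h).
  have [c c_ge0 cE] := IHs a b us la lb b_ge0'.
  exists (fun i => if i == i0 then 0 else c i); first by move=> i; case: ifP.
  move=> h; rewrite big_cons eqxx mul0r add0r cE.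
  apply: eq_big_seq => i si; case: eqP => // ii0.
  by move: i0s; rewrite -ii0 si.
move=> /existsNP[h0 /not_implyP[h0s /negP]]; rewrite -ltNge => bh0.
have ah0 : a i0 h0 < 0.
  rewrite ltNge; apply/negP => ah0; move: bh0; rewrite ltNge => /negP; apply.
  by apply: b_ge0 => i; rewrite inE => /orP[/eqP ->//|]; exact: h0s.
(* Projecting along [h0] onto the kernel of [a i0] eliminates that
   constraint. *)
pose proj h := - (a i0 h / a i0 h0) *: h0 + h.
have linB f : scalar f -> forall h, f (proj h) = f h - a i0 h / a i0 h0 * f h0.
  by move=> lf h; rewrite /proj lf mulNr addrC.
have lproj f : scalar f -> scalar (f \o proj).
  by move=> lf k u v /=; rewrite !linB// lf la; field; rewrite lt_eqF.
have [//||h hs|c c_ge0 cE] := IHs (fun i => a i \o proj) (b \o proj) us.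
- by move=> i; apply: lproj.
- exact: lproj.
- apply: b_ge0 => i; rewrite inE => /orP[/eqP ->|]; last exact: hs.
  by rewrite linB// divfK ?lt_eqF// subrr.
(* Undoing the projection in [cE] leaves a multiple of [a i0 h], and this quotient is its
   coefficient. Its numerator and denominator are both negative: [b h0 < 0], while the subtracted
   sum is nonnegative. *)
exists (fun i => if i == i0 then (b h0 - \sum_(j <- s) c j * a j h0) / a i0 h0
                 else c i).
  move=> i; case: ifP => // _; rewrite -mulrNN -invrN mulr_ge0//.
    rewrite opprB subr_ge0 (le_trans (ltW bh0))// big_seq.
    by apply: sumr_ge0 => j js; rewrite mulr_ge0 ?h0s.
  by rewrite invr_ge0 oppr_ge0 ltW.
move=> h; rewrite big_cons eqxx.
have -> : \sum_(j <- s) (if j == i0 then (b h0 - \sum_(j <- s) c j * a j h0) /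
    a i0 h0 else c j) * a j h = \sum_(j <- s) c j * a j h.
  apply: eq_big_seq => i si; case: eqP => // ii0.
  by move: i0s; rewrite -ii0 si.
have := cE h; rewrite /= linB// => /(canRL (subrK _)) ->.
under eq_bigr do rewrite linB// mulrBr mulrCA.
rewrite sumrB -mulr_sumr; field; by rewrite lt_eqF.
Qed.

Lemma farkas (R : realFieldType) (V : lmodType R) (I : finType) (E D : {pred I})
    (a : I -> V -> R) (b : V -> R) :
  (forall i, scalar (a i)) -> scalar b ->
  (forall h, (forall i, i \in E -> a i h = 0) ->
     (forall i, i \in D -> 0 <= a i h) -> 0 <= b h) ->
  exists c : I -> R,
    [/\ forall i, i \notin E -> 0 <= c i,
        forall i, i \notin E -> i \notin D -> c i = 0 &
        forall h, b h = \sum_i c i * a i h].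
Proof.
move=> la lb bED.
(* [(i, true)] stands for [0 <= a i] and [(i, false)] for [0 <= - a i] *)
pose s := [seq p <- index_enum (I * bool)%type |
            (p.1 \in E) || (p.1 \in D) && p.2].
pose a' (p : I * bool) h := (-1) ^+ (~~ p.2) * a p.1 h.
have [|||h hs|c c_ge0 cE] := @farkas_seq R V _ s a' b.
- by rewrite filter_uniq// index_enum_uniq.
- by move=> -[i [|]] k u v; rewrite /a' /= la !(expr0, expr1); ring.
- exact: lb.
- apply: bED => i Hi.
    have := hs (i, true); have := hs (i, false).
    rewrite !mem_filter/= Hi /= !mem_index_enum /a'/= expr0 expr1.
    by move=> /(_ isT) + /(_ isT); lra.
  have := hs (i, true).
  by rewrite mem_filter/= Hi orbT mem_index_enum /a'/= expr0 mul1r; exact.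
pose c' i := (if (i \in E) || (i \in D) then c (i, true) else 0) -
             (if i \in E then c (i, false) else 0).
exists c'; rewrite /c'; split.
- by move=> i /negPf ->; rewrite subr0; case: ifP.
- by move=> i /negPf -> /negPf ->; rewrite subr0.
move=> h; rewrite cE big_filter big_mkcond/=.
transitivity (\sum_i \sum_t (if (i \in E) || (i \in D) && t
  then c (i, t) * a' (i, t) h else 0)).
  by rewrite pair_bigA; apply: eq_bigr => -[].
apply: eq_bigr => i _; rewrite big_bool/= /a'/= !(expr0, expr1) andbT andbF orbF.
by case: (i \in E); case: (i \in D) => /=; ring.
Qed.

(** * Continuity of linear maps, one-sided derivative bounds and the gradient inequality *)

Section Differentials.
Context {R : realType}.

Lemma mx_linear_continuous m n (W : normedModType R)
  (f : {linear 'M[R]_(m, n) -> W}) : continuous f.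
Proof.
have -> : (f : _ -> _) =
    fun M => \sum_i \sum_j M i j *: f (delta_mx i j).
  apply/funext => M; rewrite {1}(matrix_sum_delta M) linear_sum.
  by under eq_bigr do (rewrite linear_sum; under eq_bigr do rewrite linearZ).
move=> M; apply: (cvg_big add_continuous (F := nbhs M)) => i _.
apply: (cvg_big add_continuous (F := nbhs M)) => j _.
by apply: cvgZr_tmp; exact: coord_continuous.
Qed.

(** The hypotheses range over all linear maps out of each factor, so the lemma can be iterated on
    the nested product of matrix spaces that makes up a decision. *)
Lemma pair_linear_continuous (U V W : normedModType R) :
  (forall f : {linear U -> W}, continuous f) ->
  (forall f : {linear V -> W}, continuous f) ->
  forall f : {linear (U * V)%type -> W}, continuous f.
Proof.
move=> cU cV f.
have lf1 : linear (fun x : U => f (x, 0)).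
  move=> k x y; rewrite -linearP; congr (f (_, _)).
  by rewrite /= scaler0 addr0.
have lf2 : linear (fun y : V => f (0, y)).
  move=> k x y; rewrite -linearP; congr (f (_, _)).
  by rewrite /= scaler0 addr0.
pose f1 : {linear U -> W} := HB.pack (fun x : U => f (x, 0))
  (GRing.isLinear.Build _ _ _ _ _ lf1).
pose f2 : {linear V -> W} := HB.pack (fun y : V => f (0, y))
  (GRing.isLinear.Build _ _ _ _ _ lf2).
have -> : (f : _ -> _) = fun p => f1 p.1 + f2 p.2.
  apply/funext => -[x y]; rewrite /= -linearD; congr (f (_, _)).
    by rewrite /= addr0.
  by rewrite /= add0r.
move=> p; apply: cvgD.
  apply: (@continuous_comp _ _ _ fst f1); [exact: cvg_fst | exact: cU].
apply: (@continuous_comp _ _ _ snd f2); [exact: cvg_snd | exact: cV].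
Qed.

Lemma is_diff_sum (V W : normedModType R) (I : Type) (s : seq I)
    (f df : I -> V -> W) (x : V) :
  (forall i, is_diff x (f i) (df i)) ->
  is_diff x (fun y => \sum_(i <- s) f i y) (fun y => \sum_(i <- s) df i y).
Proof.
move=> fdf; elim: s => [|i s IHs].
  under eq_fun do rewrite big_nil.
  under [X in is_diff _ _ X]eq_fun do rewrite big_nil.
  exact: is_diff_cst.
under eq_fun do rewrite big_cons.
under [X in is_diff _ _ X]eq_fun do rewrite big_cons.
exact: is_diffD.
Qed.

(** Only small [t > 0] are constrained, because a feasible direction at a boundary point is
    one-sided. *)
Lemma differential_ge (V : normedModType R) (f : V -> R) (v h : V) (c : R) :
  differentiable f v ->
  (\forall t \near (0:R)^'+, c * t <= f (v + t *: h) - f v) ->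
  c <= 'd f v h.
Proof.
move=> df fc.
have dh : t^-1 *: ((f \o shift v) (t *: h) - f v) @[t --> (0:R)^'+] --> 'd f v h.
  by apply: cvg_dnbhs_at_right; rewrite -deriveE//; exact: diff_derivable.
apply: cvgr_to_ge dh _; near=> t.
have t_gt0 : 0 < t by near: t; exact: nbhs_right_gt.
rewrite /= [t *: h + v]addrC -[_ *: _]/(_ * _) ler_pdivlMl// mulrC.
by near: t.
Unshelve. all: by end_near. Qed.

Lemma differential_le (V : normedModType R) (f : V -> R) (v h : V) (c : R) :
  differentiable f v ->
  (\forall t \near (0:R)^'+, f (v + t *: h) - f v <= c * t) ->
  'd f v h <= c.
Proof.
move=> df fc; rewrite -lerN2.
have <- : 'd (- f) v h = - 'd f v h by rewrite diffN.
apply: differential_ge; first exact: differentiableN.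
by apply: filterS fc => t; rewrite mulNr !fctE/= -opprD lerN2 => /le_trans; apply.
Qed.

(** Convexity bounds the increment of [f] from [v] to [v + t *: (v' - v)] by [t * (f v' - f v)] for
    [0 < t < 1]; the limit at [0] gives the claim. *)
Lemma convex_differential_le (V : normedModType R) (f : V -> R) (v v' : V) :
  convex_function [set: V] f -> differentiable f v ->
  'd f v (v' - v) <= f v' - f v.
Proof.
move=> cf df; apply: differential_le => //; near=> t.
have t_gt0 : 0 < t by near: t; exact: nbhs_right_gt.
have t_lt1 : t < 1 by near: t; exact: nbhs_right_lt.
pose T := Itv01 (ltW t_gt0) (ltW t_lt1).
have := cf T v' v; rewrite !inE => /(_ I I).
rewrite convRE /conv/= /unstable.onem.
have -> : t *: v' + (1 - t) *: v = v + t *: (v' - v).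
  by rewrite scalerBl scale1r scalerBr addrCA addrA.
by lra.
Unshelve. all: by end_near. Qed.

End Differentials.

(** * The constraint maps as affine functions of the decision, and the derivative of the
    Lagrangian *)

Section Decision.
Context (R : realType) (nx nu nw N : nat).
Local Notation V := (decision R nx nu nw N).
Implicit Types (sys : lc_model R nx nu nw) (v h : V).

Lemma decision_linear_continuous (W : normedModType R) (f : {linear V -> W}) :
  continuous f.
Proof.
by do 2?apply: pair_linear_continuous; exact: mx_linear_continuous.
Qed.

(** The increment is exactly [df h], so there is no remainder to estimate; continuity of [df] comes
    from the finite dimension of the decision space. *)
Lemma is_diff_affine (W : normedModType R) (f df : V -> W) v :
  linear df -> (forall v h, f (v + h) = f v + df h) -> is_diff v f df.
Proof.
move=> ldf fD.
pose g : {linear V -> W} := HB.pack df (GRing.isLinear.Build _ _ _ _ _ ldf).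
have -> : f = cst (f 0) + df by apply/funext => h; rewrite !fctE -fD add0r.
rewrite -[X in is_diff _ _ X]add0r; apply: is_diffD.
have gc : continuous g by exact: decision_linear_continuous.
by apply: DiffDef;
  [exact: (linear_differentiable (f := g)) | exact: (diff_lin (f := g))].
Qed.

Lemma xk_linear (a : R) v h k : xk (a *: v + h) k = a *: xk v k + xk h k.
Proof. by rewrite /xk linearP. Qed.

Lemma uk_linear (a : R) v h k : uk (a *: v + h) k = a *: uk v k + uk h k.
Proof. by rewrite /uk linearP. Qed.

Lemma wk_linear (a : R) v h k : wk (a *: v + h) k = a *: wk v k + wk h k.
Proof. by rewrite /wk linearP. Qed.

Lemma xkD v h k : xk (v + h) k = xk v k + xk h k.
Proof. by rewrite /xk linearD. Qed.

Lemma ukD v h k : uk (v + h) k = uk v k + uk h k.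
Proof. by rewrite /uk linearD. Qed.

Lemma wkD v h k : wk (v + h) k = wk v k + wk h k.
Proof. by rewrite /wk linearD. Qed.

Lemma xkZ (a : R) h k : xk (a *: h) k = a *: xk h k.
Proof. by rewrite /xk linearZ. Qed.

Lemma ukZ (a : R) h k : uk (a *: h) k = a *: uk h k.
Proof. by rewrite /uk linearZ. Qed.

Lemma wkZ (a : R) h k : wk (a *: h) k = a *: wk h k.
Proof. by rewrite /wk linearZ. Qed.

Lemma dotvE n (a b : 'cV[R]_n) : dotv a b = \sum_i a i 0 * b i 0.
Proof. by rewrite /dotv mxE; under eq_bigr do rewrite mxE. Qed.

Lemma dotv0 n (a : 'cV[R]_n) : dotv a 0 = 0.
Proof. by rewrite /dotv mulmx0 mxE. Qed.

Lemma dotv_linear n (c : R) (a b d : 'cV[R]_n) :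
  dotv a (c *: b + d) = c * dotv a b + dotv a d.
Proof. by rewrite /dotv linearP !mxE. Qed.

Lemma dotvDr n (a b d : 'cV[R]_n) : dotv a (b + d) = dotv a b + dotv a d.
Proof. by rewrite -[b in LHS]scale1r dotv_linear mul1r. Qed.

Lemma sum_dotv_linear n m (c : R) (a b d e : 'I_m -> 'cV[R]_n) :
  (forall k, e k = c *: b k + d k) ->
  \sum_k dotv (a k) (e k) =
  c * \sum_k dotv (a k) (b k) + \sum_k dotv (a k) (d k).
Proof.
move=> eE; rewrite mulr_sumr -big_split; apply: eq_bigr => k _.
by rewrite eE dotv_linear.
Qed.

Lemma sum_dotvDr n m (a b d e : 'I_m -> 'cV[R]_n) :
  (forall k, e k = b k + d k) ->
  \sum_k dotv (a k) (e k) = \sum_k dotv (a k) (b k) + \sum_k dotv (a k) (d k).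
Proof.
move=> eE; rewrite -[X in X + _]mul1r; apply: sum_dotv_linear => k.
by rewrite eE scale1r.
Qed.

(** Dropping the constant terms turns the affine maps [rk sys] and [defect sys] into their
    derivatives, so these derivatives need no separate definitions. *)
Definition linear_part sys : lc_model R nx nu nw :=
  LCModel (lcA sys) (lcBu sys) (lcBw sys) 0 (lcEw sys) (lcEx sys) (lcEu sys) 0.

Definition defect sys v (k : 'I_N) : 'cV[R]_nx :=
  xk v (next_stage k) - successor sys (xk v (stage k)) (uk v k) (wk v k).

Lemma rkD sys v h k : rk sys (v + h) k = rk sys v k + rk (linear_part sys) h k.
Proof.
rewrite /rk xkD ukD wkD /residual/= !mulmxDr addr0.
by apply/matrixP => i j; rewrite !mxE; ring.
Qed.

Lemma rk_linear sys (a : R) v h k : rk (linear_part sys) (a *: v + h) k =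
  a *: rk (linear_part sys) v k + rk (linear_part sys) h k.
Proof.
rewrite /rk xk_linear uk_linear wk_linear /residual/= !mulmxDr -!scalemxAr !addr0.
by apply/matrixP => i j; rewrite !mxE; ring.
Qed.

Lemma defectD sys v h k :
  defect sys (v + h) k = defect sys v k + defect (linear_part sys) h k.
Proof.
rewrite /defect !(xkD, ukD, wkD) /successor/= !mulmxDr addr0.
by apply/matrixP => i j; rewrite !mxE; ring.
Qed.

Lemma defect_linear sys (a : R) v h k : defect (linear_part sys) (a *: v + h) k =
  a *: defect (linear_part sys) v k + defect (linear_part sys) h k.
Proof.
rewrite /defect !(xk_linear, uk_linear, wk_linear) /successor/=.
rewrite !mulmxDr -!scalemxAr !addr0.
by apply/matrixP => i j; rewrite !mxE; ring.
Qed.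

Lemma rkZ sys (a : R) h k :
  rk (linear_part sys) (a *: h) k = a *: rk (linear_part sys) h k.
Proof.
by rewrite /rk /xk /uk /wk !linearZ /residual/= -!scalemxAr !addr0 !scalerDr.
Qed.

Lemma defectZ sys (a : R) h k :
  defect (linear_part sys) (a *: h) k =
  a *: defect (linear_part sys) h k.
Proof.
rewrite /defect /xk /uk /wk !linearZ /successor/= -!scalemxAr !addr0.
by rewrite scalerBr !scalerDr.
Qed.

Section Lagrangian.
Context (sys : lc_model R nx nu nw) (xbar : 'cV[R]_nx).
Context (ell : 'I_N -> 'cV[R]_nx * 'cV[R]_nu -> R) (ellN : 'cV[R]_nx -> R).
Context (ell_diff : forall (k : 'I_N) z, differentiable (ell k) z).
Context (ellN_diff : forall z, differentiable ellN z).

Lemma cost_differentiable v : differentiable (cost ell ellN) v.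
Proof.
rewrite /cost.
have dN : differentiable (fun v : V => ellN (xk v ord_max)) v.
  apply: (@differentiable_comp _ _ _ _ (fun v : V => xk v ord_max) ellN) => //.
  suff [] : is_diff v (fun v : V => xk v ord_max) (fun h => xk h ord_max) by [].
  apply: is_diff_affine => [a|] u h; first exact: xk_linear.
  exact: xkD.
have dk k : differentiable (fun v : V => ell k (xk v (stage k), uk v k)) v.
  apply: (@differentiable_comp _ _ _ _
    (fun v : V => (xk v (stage k), uk v k)) (ell k)) => //.
  suff [] : is_diff v (fun v : V => (xk v (stage k), uk v k))
    (fun h => (xk h (stage k), uk h k)) by [].
  apply: is_diff_affine => [a|] u h; first by rewrite xk_linear uk_linear.
  by rewrite xkD ukD.
have dS : differentiable (fun v : V => \sum_k ell k (xk v (stage k), uk v k)) v.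
  have := is_diff_sum (index_enum 'I_N) (fun k => differentiableP (dk k)).
  by case.
exact: differentiableD.
Qed.

(** The directional derivative of the Lagrangian at [v] along [h]; the factor of [mult_xi l] is the
    product rule applied to the orthogonality term. *)
Definition dlagrangian (l : multipliers R nx nw N) v h : R :=
  'd (cost ell ellN) v h + dotv (mult_pi l) (xk h ord0)
  + \sum_k dotv (mult_mu l k) (defect (linear_part sys) h k)
  - \sum_k dotv (mult_nuG l k) (rk (linear_part sys) h k)
  - \sum_k dotv (mult_nuH l k) (wk h k)
  + mult_xi l * \sum_k (dotv (rk sys v k) (wk h k) +
                        dotv (wk v k) (rk (linear_part sys) h k)).

Lemma lagrangian_is_diff l v :
  is_diff v (lagrangian sys xbar ell ellN l) (dlagrangian l v).
Proof.
(* [f] collects the affine terms, which leaves only the cost and the bilinear orthogonality term to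
   differentiate separately. *)
pose f v' : R := dotv (mult_pi l) (xk v' ord0 - xbar)
  + \sum_k dotv (mult_mu l k) (defect sys v' k)
  - \sum_k dotv (mult_nuG l k) (rk sys v' k)
  - \sum_k dotv (mult_nuH l k) (wk v' k).
pose df h : R := dotv (mult_pi l) (xk h ord0)
  + \sum_k dotv (mult_mu l k) (defect (linear_part sys) h k)
  - \sum_k dotv (mult_nuG l k) (rk (linear_part sys) h k)
  - \sum_k dotv (mult_nuH l k) (wk h k).
have fdf : is_diff v f df.
  apply: is_diff_affine => [a v' h|v' h].
    rewrite /df xk_linear dotv_linear.
    rewrite (sum_dotv_linear _ (fun k => defect_linear sys a v' h k)).
    rewrite (sum_dotv_linear _ (fun k => rk_linear sys a v' h k)).
    rewrite (sum_dotv_linear _ (fun k => wk_linear a v' h k)).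
    by rewrite -[_ *: _]/(_ * _); ring.
  rewrite /f /df (sum_dotvDr _ (fun k => defectD sys v' h k)).
  rewrite (sum_dotvDr _ (fun k => rkD sys v' h k)).
  rewrite (sum_dotvDr _ (fun k => wkD v' h k)) xkD.
  by rewrite (addrAC (xk v' ord0)) !dotvDr; ring.
have gdg : is_diff v (fun v' => \sum_k dotv (rk sys v' k) (wk v' k))
    (fun h => \sum_k (dotv (rk sys v k) (wk h k) +
                      dotv (wk v k) (rk (linear_part sys) h k))).
  apply: is_diff_sum => k.
  under eq_fun do rewrite dotvE.
  apply: (is_diff_eq (f' := fun h => \sum_i (rk sys v k i 0 * wk h k i 0 +
    wk v k i 0 * rk (linear_part sys) h k i 0))); last first.
    by apply/funext => h; rewrite big_split -!dotvE.
  apply: is_diff_sum => i.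
  apply: is_diffM.
    apply: is_diff_affine => [a v' h|v' h]; last by rewrite rkD mxE.
    by rewrite rk_linear !mxE.
  apply: is_diff_affine => [a v' h|v' h]; first by rewrite wk_linear !mxE.
  by rewrite wkD mxE.
have := is_diffD (is_diffD (differentiableP (cost_differentiable v)) fdf)
  (is_diffZ (mult_xi l) gdg).
congr is_diff_def; apply/funext => u; rewrite !fctE /lagrangian /dlagrangian.
  by rewrite /f /= !addrA.
by rewrite /df /= !addrA.
Qed.

Lemma kkt_stationary l v : is_diff v (lagrangian sys xbar ell ellN l) (cst 0) <->
  forall h, dlagrangian l v h = 0.
Proof.
have ld := lagrangian_is_diff l v.
split=> [d0 h|d0]; last first.
  by apply: is_diff_eq ld _; apply/funext.
by rewrite -(@diff_val _ _ _ _ _ _ _ ld) (@diff_val _ _ _ _ _ _ _ d0).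
Qed.

End Lagrangian.
End Decision.

(** * Solutions of the complementarity problem with rank-one blocks *)

Section Complementarity.
Context (R : realType) (nx nu nw : nat) (sys : lc_model R nx nu nw).

Lemma complementary_mul n (a b : 'cV[R]_n) i :
  complementary a b -> a i 0 * b i 0 = 0.
Proof.
move=> [a0 b0]; rewrite dotvE => /eqP.
by rewrite psumr_eq0 => [/allP /(_ i) /(_ (mem_index_enum _))/= /eqP //|j _];
  rewrite mulr_ge0.
Qed.

(* If [w j] and its residual both vanish, some [w j0 > 0] lies in the same
   block, and moving mass from [j0] to [j] so that [m^T w] is preserved yields
   another solution; well-posedness then puts the direction in the kernel of
   [lcBw]. *)
Lemma degenerate_direction (P : block_partition nw) x u w j :
  well_posed sys -> rank_one_blocks sys P -> nontrivial_subproblems sys P ->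
  complementary (residual sys x u w) w ->
  residual sys x u w j 0 = 0 -> w j 0 = 0 ->
  exists d : 'cV[R]_nw,
    [/\ lcEw sys *m d = 0, lcBw sys *m d = 0, d j 0 = 1 &
        forall l, l != j -> d l 0 != 0 -> 0 < w l 0].
Proof.
move=> wp [off_diag diag] nontriv cw rj wj.
have [r_ge0 w_ge0 _] := cw.
have [g _ gK] := bindexP P.
have blockE l : exists p : {i : 'I_(nblocks P) & 'I_(bsize i)},
  l = bindex (tagged p) by exists (g l); rewrite gK.
have [[i a] /= jE] := blockE j.
have [m m_neq0 mE] := diag i.
have EwE b b' : lcEw sys (bindex b) (bindex b') = m b 0 * m b' 0.
  have /matrixP/(_ b b') := mE; rewrite !mxE big_ord1 mxE; exact.
have Ew0 i' (b' : 'I_(bsize i')) b : i' != i ->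
    lcEw sys (bindex b') (@bindex _ P i b) = 0.
  by move=> /off_diag /matrixP/(_ b' b); rewrite !mxE.
have Ew0' i' (b' : 'I_(bsize i')) b : i' != i ->
    lcEw sys (@bindex _ P i b) (bindex b') = 0.
  by rewrite eq_sym => /off_diag /matrixP/(_ b b'); rewrite !mxE.
(* If [w] vanished on the whole block, then so would [lcEw sys *m w] there, the off-diagonal blocks
   being zero. The residual would then reduce to the expression that nontriviality makes negative at
   some index. *)
have [b wb] : exists b : 'I_(bsize i), 0 < w (bindex b) 0.
  apply: contrapT => /forallNP w_le0.
  have [b] := nontriv x u i.
  have -> : (blockC sys i *m x + blockD sys i *m u + blocke sys i) b 0 =
      residual sys x u w (bindex b) 0.
    rewrite !mxE [X in _ = X + _ + _ + _]big1 => [|l _]; last first.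
      have [[i' b'] /= ->] := blockE l.
      have [ii'|/Ew0' ->] := eqVneq i' i; last by rewrite mul0r.
      subst i'; suff -> : w (bindex b') 0 = 0 by rewrite mulr0.
      apply/eqP; rewrite eq_le w_ge0 andbT leNgt; apply/negP; exact: w_le0.
    by rewrite add0r; do 2?congr (_ + _); apply: eq_bigr => l _; rewrite mxE.
  by rewrite ltNge r_ge0.
set j0 := bindex b in wb.
have rj0 : residual sys x u w j0 0 = 0.
  by have /eqP := complementary_mul j0 cw; rewrite mulf_eq0 (gt_eqF wb) orbF => /eqP.
have jj0 : j0 != j by apply/eqP => E; move: wb; rewrite E wj ltxx.
(* The ratio for which [m a 0 - c * m b 0 = 0], so that [d] is orthogonal to [m] within the
   block. *)
pose c := m a 0 / m b 0.
pose d : 'cV[R]_nw := delta_mx j 0 - c *: delta_mx j0 0.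
have dE l : d l 0 = (l == j)%:R - c * (l == j0)%:R.
  by rewrite !mxE eqxx !andbT.
have Ewd : lcEw sys *m d = 0.
  rewrite mulmxBr -scalemxAr -!colE; apply/matrixP => l o; rewrite !mxE.
  have [[i' b'] /= ->] := blockE l; rewrite jE /j0.
  have [ii'|ii'] := eqVneq i' i; last by rewrite !Ew0// mulr0 subr0.
  by subst i'; rewrite !EwE /c; field; exact: m_neq0.
(* A step short enough to keep [w j0 0 - eps * c] nonnegative; the [1 +] keeps the denominator
   positive whatever [c] is. *)
pose eps := w j0 0 / (1 + `|c|).
have eps_gt0 : 0 < eps by rewrite divr_gt0// ltr_wpDr.
have epsc : eps * c <= w j0 0.
  rewrite /eps mulrAC ler_pdivrMr ?ltr_wpDr// ler_wpM2l ?(ltW wb)//.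
  by rewrite (le_trans (ler_norm c))// lerDr.
have rE : residual sys x u (w + eps *: d) = residual sys x u w.
  by rewrite /residual mulmxDr -scalemxAr Ewd scaler0 addr0.
exists d; split => //; last 2 first.
- by rewrite dE eqxx eq_sym (negPf jj0) mulr0 subr0.
- move=> l lj; rewrite dE (negPf lj) sub0r oppr_eq0 mulf_eq0 negb_or => /andP[_].
  by case: (l =P j0) => [->//|]; rewrite eqxx.
have cw' : complementary (residual sys x u (w + eps *: d)) (w + eps *: d).
  rewrite rE; split=> //.
    move=> l; rewrite mxE [X in _ + X]mxE dE.
    have [->|lj] := eqVneq l j.
      by rewrite [j == j0]eq_sym (negPf jj0) wj/=; lra.
    have [->|lj0] := eqVneq l j0; first by rewrite /=; lra.
    by have := w_ge0 l; rewrite /=; lra.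
  rewrite dotvE big1// => l _.
  rewrite [(w + _) l 0]mxE mulrDr complementary_mul// add0r.
  rewrite [(eps *: d) l 0]mxE dE.
  have [->|lj] := eqVneq l j; first by rewrite rj mul0r.
  have [->|lj0] := eqVneq l j0; first by rewrite rj0 mul0r.
  by rewrite mulr0 subr0 !mulr0.
have := wp _ _ _ _ cw cw'; rewrite /successor => /addIr/addrI.
rewrite mulmxDr -[X in X = _]addr0 => /addrI /esym.
by rewrite -scalemxAr => /eqP; rewrite scaler_eq0 (gt_eqF eps_gt0) => /eqP.
Qed.

End Complementarity.

(** * Sufficiency of the KKT conditions, and tangent directions at a local optimum *)

Section KKT.
Context (R : realType) (nx nu nw N : nat).
Local Notation V := (decision R nx nu nw N).
Context (sys : lc_model R nx nu nw) (xbar : 'cV[R]_nx).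
Context (ell : 'I_N -> 'cV[R]_nx * 'cV[R]_nu -> R) (ellN : 'cV[R]_nx -> R).
Context (ell_diff : forall (k : 'I_N) z, differentiable (ell k) z).
Context (ellN_diff : forall z, differentiable ellN z).
Local Notation J := (cost ell ellN).
Local Notation lsys := (linear_part sys).
Implicit Types v h : V.

Lemma cost_convex :
  (forall k, convex_function [set: _] (ell k)) ->
  convex_function [set: _] ellN -> convex_function [set: V] J.
Proof.
move=> ell_convex ellN_convex t v v' _ _.
rewrite convRE /cost !mulrDr addrACA !mulr_sumr -big_split/=.
rewrite lerD//.
  rewrite /xk linearD !linearZ/=.
  by have := ellN_convex t (xk v ord_max) (xk v' ord_max); rewrite !inE; apply.
apply: ler_sum => k _; rewrite /xk /uk !linearD !linearZ/=.
have := ell_convex k t (xk v (stage k), uk v k) (xk v' (stage k), uk v' k).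
by rewrite !inE; apply.
Qed.

(** Near [v] no new component of [w] can vanish; together with [near_rk_gt0] this fixes the
    complementarity pattern outside the biactive indices. *)
Lemma near_wk_gt0 v :
  \forall v' \near v, forall k i, 0 < wk v k i 0 -> 0 < wk v' k i 0.
Proof.
have wc k i : {for v, continuous (fun v' : V => wk v' k i 0)}.
  apply: differentiable_continuous.
  suff [] : is_diff v (fun v' : V => wk v' k i 0) (fun h => wk h k i 0) by [].
  apply: is_diff_affine => [a v' h|v' h]; first by rewrite wk_linear !mxE.
  by rewrite wkD mxE.
apply: (filter_forall (F := nbhs v)) => k.
apply: (filter_forall (F := nbhs v)) => i.
have [w_gt0|_] := boolP (0 < wk v k i 0); last exact: nearW.
by apply: filterS (cvgr_gt _ (wc k i) _ w_gt0).
Qed.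

Lemma near_rk_gt0 v :
  \forall v' \near v, forall k i, 0 < rk sys v k i 0 -> 0 < rk sys v' k i 0.
Proof.
have rc k i : {for v, continuous (fun v' : V => rk sys v' k i 0)}.
  apply: differentiable_continuous.
  suff [] : is_diff v (fun v' : V => rk sys v' k i 0)
                      (fun h => rk lsys h k i 0) by [].
  apply: is_diff_affine => [a v' h|v' h]; first by rewrite rk_linear !mxE.
  by rewrite rkD mxE.
apply: (filter_forall (F := nbhs v)) => k.
apply: (filter_forall (F := nbhs v)) => i.
have [r_gt0|_] := boolP (0 < rk sys v k i 0); last exact: nearW.
by apply: filterS (cvgr_gt _ (rc k i) _ r_gt0).
Qed.

Lemma kkt_locally_optimal v l :
  convex_function [set: V] J -> feasible sys xbar v ->
  kkt sys xbar ell ellN v l -> locally_optimal sys xbar ell ellN v.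
Proof.
move=> J_convex fv [/(kkt_stationary _ _ ell_diff ellN_diff) Lv G_ge0 H_ge0 G0 H0].
split=> //; near=> v' => fv'.
have w_gt0 : forall k i, 0 < wk v k i 0 -> 0 < wk v' k i 0.
  by near: v'; exact: near_wk_gt0.
have r_gt0 : forall k i, 0 < rk sys v k i 0 -> 0 < rk sys v' k i 0.
  by near: v'; exact: near_rk_gt0.
rewrite -subr_ge0.
have Jd := cost_differentiable ell_diff ellN_diff v.
apply: le_trans (convex_differential_le v' J_convex Jd).
have [x0 dyn] := fv; have [x0' dyn'] := fv'.
have [h hE] : exists h, v' = v + h by exists (v' - v); rewrite addrC subrK.
rewrite [v' - v](_ : _ = h); last by rewrite hE addrC addKr.
have xh : xk h ord0 = 0.
  by apply: (addrI (xk v ord0)); rewrite -xkD -hE x0 x0' addr0.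
have dh k : defect lsys h k = 0.
  have defect0 u : feasible sys xbar u -> defect sys u k = 0.
    by move=> [_ /(_ k)[+ _]]; rewrite /defect => ->; rewrite subrr.
  by apply: (addrI (defect sys v k)); rewrite -defectD -hE !defect0// addr0.
have dr k i : rk lsys h k i 0 = rk sys v' k i 0 - rk sys v k i 0.
  by rewrite hE rkD [X in _ = X - _]mxE addrAC subrr add0r.
have dw k i : wk h k i 0 = wk v' k i 0 - wk v k i 0.
  by rewrite hE wkD [X in _ = X - _]mxE addrAC subrr add0r.
have := Lv h; rewrite /dlagrangian xh dotv0 addr0.
rewrite [X in _ + X - _ - _ + _]big1 => [|k _]; last by rewrite dh dotv0.
move=> E.
(* Stationarity along [h], whose initial-state and dynamics terms vanish, makes this sum equal to
   the derivative of the cost. *)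
suff : 0 <= \sum_k (dotv (mult_nuG l k) (rk lsys h k) +
   dotv (mult_nuH l k) (wk h k) - mult_xi l * (dotv (rk sys v k) (wk h k) +
   dotv (wk v k) (rk lsys h k))).
  by rewrite sumrB big_split/= -mulr_sumr; move: E; lra.
apply: sumr_ge0 => k _; rewrite !dotvE -!big_split/= mulr_sumr -sumrB.
apply: sumr_ge0 => i _; rewrite dr dw.
have [_ cv] := dyn k; have [_ cv'] := dyn' k.
have rw := complementary_mul i cv; have rw' := complementary_mul i cv'.
have [r_ge0 w_ge0 _] := cv; have [r'_ge0 w'_ge0 _] := cv'.
(* Where [w] or [r] is positive at [v], its partner vanishes at both [v] and [v'], and the summand
   is zero. At a biactive index the [xi] term drops out and only products of nonnegative factors
   remain. *)
have := w_ge0 i; rewrite le_eqVlt => /predU1P[w0|w_pos]; last first.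
  have r0 : rk sys v k i 0 = 0 by apply: (mulIf (lt0r_neq0 w_pos)); rewrite mul0r.
  have r'0 : rk sys v' k i 0 = 0.
    by apply: (mulIf (lt0r_neq0 (w_gt0 _ _ w_pos))); rewrite mul0r.
  by rewrite r0 r'0 H0//; lra.
have := r_ge0 i; rewrite le_eqVlt => /predU1P[r0|r_pos]; last first.
  have w'0 : wk v' k i 0 = 0.
    by apply: (mulfI (lt0r_neq0 (r_gt0 _ _ r_pos))); rewrite mulr0.
  by rewrite -w0 w'0 G0//; lra.
rewrite -r0 -w0 !subr0 !mul0r !addr0 mulr0 subr0.
by rewrite addr_ge0// mulr_ge0//; [exact: G_ge0 | exact: H_ge0].
Unshelve. all: by end_near. Qed.

(** The cost does not involve [w], so it is constant along a displacement of [w] alone. This is what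
    makes the direction from [degenerate_direction] usable on the stationarity equation. *)
Lemma cost_input_invariant v h :
  (forall k, xk h k = 0) -> (forall k, uk h k = 0) -> 'd J v h = 0.
Proof.
move=> xh uh.
have Jh t : J (v + t *: h) = J v.
  rewrite /cost xkD xkZ xh scaler0 addr0; congr (_ + _).
  by apply: eq_bigr => k _; rewrite xkD ukD xkZ ukZ xh uh !scaler0 !addr0.
have Jd := cost_differentiable ell_diff ellN_diff v.
apply: le_anti; apply/andP; split.
  by apply: differential_le => //; apply: nearW => t; rewrite Jh subrr mul0r.
by apply: differential_ge => //; apply: nearW => t; rewrite Jh subrr mul0r.
Qed.

(* The cone is tangent to the branch of the feasible set on which every [w]
   component vanishing at [v] is kept at zero. *)
Lemma locally_optimal_tangent v h :
  locally_optimal sys xbar ell ellN v ->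
  xk h ord0 = 0 -> (forall k, defect lsys h k = 0) ->
  (forall k i, 0 < wk v k i 0 -> rk lsys h k i 0 = 0) ->
  (forall k i, wk v k i 0 = 0 -> wk h k i 0 = 0) ->
  (forall k i, rk sys v k i 0 = 0 -> wk v k i 0 = 0 -> 0 <= rk lsys h k i 0) ->
  0 <= 'd J v h.
Proof.
move=> [[x0 dyn] opt] xh dh rh wh r_biactive.
apply: differential_ge; first exact: cost_differentiable.
have vt : v + t *: h @[t --> (0:R)^'+] --> v.
  rewrite -[X in _ --> X]addr0 -(scale0r h); apply: cvgD; first exact: cvg_cst.
  by apply: cvgZr_tmp; apply: cvg_at_right_filter; exact: cvg_id.
near=> t; rewrite mul0r subr_ge0.
have t_gt0 : 0 < t by near: t; exact: nbhs_right_gt.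
have w_gt0 : forall k i, 0 < wk v k i 0 -> 0 < wk (v + t *: h) k i 0.
  by near: t; exact: (vt _ (near_wk_gt0 v)).
have r_gt0 : forall k i, 0 < rk sys v k i 0 -> 0 < rk sys (v + t *: h) k i 0.
  by near: t; exact: (vt _ (near_rk_gt0 v)).
suff : feasible sys xbar (v + t *: h) by near: t; exact: (vt _ opt).
split=> [|k]; first by rewrite xkD xkZ xh scaler0 addr0.
have [xS cv] := dyn k; have [r_ge0 w_ge0 _] := cv.
split.
  apply/eqP; rewrite -subr_eq0 -/(defect _ _ _) defectD defectZ dh scaler0.
  by rewrite addr0 /defect xS subrr.
have rE i : rk sys (v + t *: h) k i 0 = rk sys v k i 0 + t * rk lsys h k i 0.
  by rewrite rkD rkZ !mxE.
have wE i : wk (v + t *: h) k i 0 = wk v k i 0 + t * wk h k i 0.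
  by rewrite wkD wkZ !mxE.
(* A positive component at [v] stays positive for small [t], and its partner stays at zero by the
   choice of [h]. At a biactive index [w] stays zero while [r] may grow. *)
have ge0P i : [/\ 0 <= rk sys (v + t *: h) k i 0, 0 <= wk (v + t *: h) k i 0 &
    rk sys (v + t *: h) k i 0 * wk (v + t *: h) k i 0 = 0].
  have rw := complementary_mul i cv.
  have := w_ge0 i; rewrite le_eqVlt => /predU1P[w0|w_pos].
    rewrite wE -w0 wh// mulr0 add0r mulr0; split=> //.
    have := r_ge0 i; rewrite le_eqVlt => /predU1P[r0|r_pos].
      by rewrite rE -r0 add0r mulr_ge0 ?(ltW t_gt0)// r_biactive.
    by rewrite ltW// r_gt0.
  have r0 : rk sys v k i 0 = 0 by apply: (mulIf (lt0r_neq0 w_pos)); rewrite mul0r.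
  by rewrite rE r0 rh// mulr0 addr0 mul0r; split=> //; exact/ltW/w_gt0.
split=> [i|i|]; [by case: (ge0P i)|by case: (ge0P i)|].
by rewrite dotvE big1// => i _; case: (ge0P i).
Unshelve. all: by end_near. Qed.

End KKT.

(** * Necessity of the KKT conditions *)

Section Multipliers.
Context (R : realType) (nx nu nw N : nat).
Local Notation V := (decision R nx nu nw N).
Context (sys : lc_model R nx nu nw) (xbar : 'cV[R]_nx).
Context (ell : 'I_N -> 'cV[R]_nx * 'cV[R]_nu -> R) (ellN : 'cV[R]_nx -> R).
Context (ell_diff : forall (k : 'I_N) z, differentiable (ell k) z).
Context (ellN_diff : forall z, differentiable ellN z).
Local Notation J := (cost ell ellN).
Local Notation lsys := (linear_part sys).
Implicit Types v h : V.

(** One finite type indexes the initial-state, dynamics, residual and [w] constraints, so that a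
    single use of [farkas] yields all multipliers. *)
Local Notation cindex := ('I_nx + 'I_N * 'I_nx + ('I_N * 'I_nw + 'I_N * 'I_nw))%type.

Definition constraint (i : cindex) h : R :=
  match i with
  | inl (inl a) => xk h ord0 a 0
  | inl (inr (k, a)) => defect lsys h k a 0
  | inr (inl (k, a)) => rk lsys h k a 0
  | inr (inr (k, a)) => wk h k a 0
  end.

Lemma constraint_scalar i : scalar (constraint i).
Proof.
move=> c h h'; case: i => [[a|[k a]]|[[k a]|[k a]]] /=.
- by rewrite xk_linear !mxE.
- by rewrite defect_linear 2!mxE.
- by rewrite rk_linear 2!mxE.
- by rewrite wk_linear !mxE.
Qed.

(** These are multipliers for the branch, not yet for (P): [G] may be negative where [w] is
    positive, and [H] has no sign where [w] vanishes. *)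
Lemma locally_optimal_multipliers v :
  locally_optimal sys xbar ell ellN v ->
  exists (p : 'cV[R]_nx) (mu : 'I_N -> 'cV[R]_nx) (G H : 'I_N -> 'cV[R]_nw),
  [/\ forall k i, wk v k i 0 = 0 -> 0 <= G k i 0,
      forall k i, 0 < rk sys v k i 0 -> G k i 0 = 0,
      forall k i, 0 < wk v k i 0 -> H k i 0 = 0 &
      forall h, 'd J v h = dotv p (xk h ord0)
        + \sum_k dotv (mu k) (defect lsys h k)
        + \sum_k dotv (G k) (rk lsys h k) + \sum_k dotv (H k) (wk h k)].
Proof.
move=> vopt; have [[_ dyn] _] := vopt.
(* [E] lists the constraints kept as equalities on the branch; [D] lists the residuals at biactive
   indices, which may only increase. *)
pose E (i : cindex) := match i with
  | inl _ => true
  | inr (inl (k, a)) => 0 < wk v k a 0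
  | inr (inr (k, a)) => wk v k a 0 == 0
  end.
pose D (i : cindex) := match i with
  | inr (inl (k, a)) => (rk sys v k a 0 == 0) && (wk v k a 0 == 0)
  | _ => false
  end.
have [||h hE hD|c [c_ge0 c0 cE]] :=
    @farkas R V cindex E D constraint ('d J v : V -> R).
- exact: constraint_scalar.
- by move=> a u h; rewrite linearP.
- apply: (locally_optimal_tangent ell_diff ellN_diff vopt).
  + by apply/matrixP => a o; rewrite ord1 [RHS]mxE; apply: (hE (inl (inl a))).
  + by move=> k; apply/matrixP => a o; rewrite ord1 [RHS]mxE;
      apply: (hE (inl (inr (k, a)))).
  + by move=> k a w_gt0; apply: (hE (inr (inl (k, a)))).
  + by move=> k a w0; apply: (hE (inr (inr (k, a)))); rewrite unfold_in/= w0.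
  + move=> k a r0 w0; apply: (hD (inr (inl (k, a)))).
    by rewrite unfold_in/= r0 w0 !eqxx.
exists (\col_a c (inl (inl a))), (fun k => \col_a c (inl (inr (k, a)))),
  (fun k => \col_a c (inr (inl (k, a)))), (fun k => \col_a c (inr (inr (k, a)))).
split.
- by move=> k i w0; rewrite mxE c_ge0// unfold_in/= w0 ltxx.
- move=> k i r_gt0; rewrite mxE c0// unfold_in/=; last by rewrite gt_eqF.
  have [_ cv] := dyn k; have := complementary_mul i cv => /eqP.
  by rewrite mulf_eq0 (gt_eqF r_gt0) => /eqP ->; rewrite ltxx.
- by move=> k i w_gt0; rewrite mxE c0// unfold_in/= gt_eqF.
have pairE n (e : 'I_N * 'I_n -> R) (F : 'I_N -> 'cV[R]_n) :
    \sum_q e q * F q.1 q.2 0 = \sum_k dotv (\col_a e (k, a)) (F k).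
  transitivity (\sum_k \sum_a e (k, a) * F k a 0).
    by rewrite pair_bigA; apply: eq_bigr => -[].
  by apply: eq_bigr => k _; rewrite dotvE; apply: eq_bigr => a _; rewrite mxE.
move=> h; rewrite cE !big_sumType/= -!addrA; congr (_ + (_ + (_ + _))).
- by rewrite dotvE; apply: eq_bigr => a _; rewrite mxE.
- by rewrite -(pairE _ (fun q => c (inl (inr q))) (defect lsys h));
    apply: eq_bigr => -[].
- by rewrite -(pairE _ (fun q => c (inr (inl q))) (rk lsys h));
    apply: eq_bigr => -[].
- by rewrite -(pairE _ (fun q => c (inr (inr q))) (wk h)); apply: eq_bigr => -[].
Qed.

Lemma locally_optimal_kkt (P : block_partition nw) v :
  well_posed sys -> rank_one_blocks sys P -> nontrivial_subproblems sys P ->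
  locally_optimal sys xbar ell ellN v ->
  exists l, kkt sys xbar ell ellN v l.
Proof.
move=> wp rank nontriv vopt; have [[_ dyn] _] := vopt.
have [p [mu [G [H [G_ge0 G0 H0 JE]]]]] := locally_optimal_multipliers vopt.
have H_biactive k i : rk sys v k i 0 = 0 -> wk v k i 0 = 0 -> H k i 0 = 0.
  move=> r0 w0; have [_ cv] := dyn k.
  have [d [Ed Bd di d_supp]] := degenerate_direction wp rank nontriv cv r0 w0.
  (* The displacement [d] of [w] at stage [k] alone. It leaves cost, dynamics and residuals
     unchanged to first order, so the multiplier identity reduces to [dotv (H k) d = 0]. Elsewhere
     in the support of [d], [w] is positive and [H] is zero, which isolates [H k i 0]. *)
  pose h : V := (0, 0, \matrix_(a, b) (d a 0 *+ (b == k))).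
  have xh k' : xk h k' = 0 by rewrite /xk /= linear0.
  have uh k' : uk h k' = 0 by rewrite /uk /= linear0.
  have wh k' : wk h k' = (k' == k)%:R *: d.
    by apply/matrixP => a b; rewrite !mxE ord1 mulr_natl.
  have := JE h; rewrite (cost_input_invariant ell_diff ellN_diff)// xh dotv0 add0r.
  rewrite [X in X + _ + _]big1 => [|k' _]; last first.
    rewrite /defect xh uh xh wh /successor/= !mulmx0 -scalemxAr Bd scaler0.
    by rewrite !addr0 subrr dotv0.
  rewrite [X in _ + X + _]big1 => [|k' _]; last first.
    by rewrite /rk xh uh wh /residual/= !mulmx0 -scalemxAr Ed scaler0 !addr0 dotv0.
  rewrite !add0r (bigD1 k)//= [X in _ + X]big1 => [|k' /negPf k'k]; last first.
    by rewrite wh k'k scale0r dotv0.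
  rewrite addr0 wh eqxx scale1r dotvE (bigD1 i)//= di mulr1 big1 ?addr0// => a ai.
  have [->|da] := eqVneq (d a 0) 0; first by rewrite mulr0.
  by rewrite H0 ?mul0r// d_supp.
(* Large enough to absorb the negative part of [G] where [w > 0] and of [H]
   where the residual is positive; the terms divided by zero are junk zeros. *)
pose xi := \sum_k \sum_i (`|G k i 0| / wk v k i 0 + `|H k i 0| / rk sys v k i 0).
have term_ge0 k i :
    0 <= `|G k i 0| / wk v k i 0 /\ 0 <= `|H k i 0| / rk sys v k i 0.
  have [_ [r_ge0 w_ge0 _]] := dyn k.
  by split; rewrite divr_ge0.
have xi_ge k i : `|G k i 0| / wk v k i 0 + `|H k i 0| / rk sys v k i 0 <= xi.
  rewrite /xi (bigD1 k)//= (bigD1 i)//= -addrA lerDl addr_ge0// sumr_ge0//.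
    by move=> a _; have [] := term_ge0 k a; exact: addr_ge0.
  move=> k' _; apply: sumr_ge0 => a _; have [] := term_ge0 k' a; exact: addr_ge0.
(* The orthogonality term contributes [xi] times the sum of [r] against the change of [w] and [w]
   against the change of [r]; these shifts cancel it exactly. Complementary slackness survives,
   since each shift vanishes where the partner is positive. *)
pose nuG k := G k + xi *: wk v k.
pose nuH k := H k + xi *: rk sys v k.
have nuGE k i : nuG k i 0 = G k i 0 + xi * wk v k i 0.
  by rewrite mxE; congr (_ + _); rewrite mxE.
have nuHE k i : nuH k i 0 = H k i 0 + xi * rk sys v k i 0.
  by rewrite mxE; congr (_ + _); rewrite mxE.
(* The Lagrangian adds the [pi] and [mu] terms but subtracts the [nuG] and [nuH] terms, whereas [JE]
   has all four with a plus sign; hence the negations. *)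
exists (Multipliers (- p) (fun k => - mu k) nuG nuH xi); split=> /=.
- apply/(kkt_stationary _ _ ell_diff ellN_diff) => h.
  rewrite /dlagrangian JE/=.
  have DlN n (a b : 'cV[R]_n) : dotv (- a) b = - dotv a b.
    by rewrite !dotvE -sumrN; apply: eq_bigr => j _; rewrite mxE mulNr.
  have DlD n (a b e : 'cV[R]_n) : dotv (a + xi *: b) e = dotv a e + xi * dotv b e.
    rewrite !dotvE mulr_sumr -big_split; apply: eq_bigr => j _.
    by rewrite !mxE mulrDl mulrA.
  under [X in _ + X - _ - _ + _]eq_bigr do rewrite DlN.
  under [X in _ - X - _ + _]eq_bigr do rewrite DlD.
  under [X in _ - _ - X + _]eq_bigr do rewrite DlD.
  rewrite DlN sumrN !big_split/= -!mulr_sumr; ring.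
- move=> k i; rewrite nuGE.
  have [_ [_ w_ge0 _]] := dyn k.
  have := w_ge0 i; rewrite le_eqVlt => /predU1P[w0|w_gt0].
    by rewrite -w0 mulr0 addr0 G_ge0.
  have [_ H_term] := term_ge0 k i.
  have : `|G k i 0| / wk v k i 0 <= xi by have := xi_ge k i; lra.
  rewrite ler_pdivrMr// => G_le; have := ler_norm (- G k i 0).
  by rewrite normrN; lra.
- move=> k i; rewrite nuHE.
  have [_ [r_ge0 w_ge0 _]] := dyn k.
  have := r_ge0 i; rewrite le_eqVlt => /predU1P[r0|r_gt0].
    have := w_ge0 i; rewrite le_eqVlt => /predU1P[w0|w_gt0].
      by rewrite -r0 mulr0 addr0 H_biactive.
    by rewrite -r0 mulr0 addr0 H0.
  have [G_term _] := term_ge0 k i.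
  have : `|H k i 0| / rk sys v k i 0 <= xi by have := xi_ge k i; lra.
  rewrite ler_pdivrMr// => H_le; have := ler_norm (- H k i 0).
  by rewrite normrN; lra.
- move=> k i r_gt0; have [_ cv] := dyn k.
  have /eqP := complementary_mul i cv; rewrite mulf_eq0 (gt_eqF r_gt0) => /eqP w0.
  by rewrite nuGE G0// w0 mulr0 addr0.
- move=> k i w_gt0; have [_ cv] := dyn k.
  have /eqP := complementary_mul i cv.
  rewrite mulf_eq0 (gt_eqF w_gt0) orbF => /eqP r0.
  by rewrite nuHE H0// r0 mulr0 addr0.
Qed.

End Multipliers.

Theorem theorem1 (R : realType) (nx nu nw : nat) (sys : lc_model R nx nu nw)
    (P : block_partition nw) (N : nat) (xbar : 'cV[R]_nx)
    (ell : 'I_N -> 'cV[R]_nx * 'cV[R]_nu -> R) (ellN : 'cV[R]_nx -> R)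
    (hN : (0 < N)%N)
    (hell_convex : forall k : 'I_N, convex_function [set: _] (ell k))
    (hell_diff : forall (k : 'I_N) z, differentiable (ell k) z)
    (hellN_convex : convex_function [set: _] ellN)
    (hellN_diff : forall z, differentiable ellN z)
    (hwp : well_posed sys)
    (hrank : rank_one_blocks sys P)
    (hnontriv : nontrivial_subproblems sys P)
    (vstar : decision R nx nu nw N)
    (hfeas : feasible sys xbar vstar) :
  locally_optimal sys xbar ell ellN vstar <->
  exists l : multipliers R nx nw N, kkt sys xbar ell ellN vstar l.
Proof.
split=> [|[l]]; last first.
  by apply: kkt_locally_optimal => //; exact: cost_convex.
exact: (locally_optimal_kkt hell_diff hellN_diff hwp hrank hnontriv).
Qed.
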